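(* Suppose that $\varepsilon=0$ and $$\Sigma_{\mathrm{pk}}=\{(A,B)\in\Sigma_{\mathrm{cont}}\mid A\in\mathcal{A}_{\mathrm{pk}},\ \|B\|<\beta\},$$ where $\beta>0$ and $\mathcal{A}_{\mathrm{pk}}\subseteq\mathbb{R}^{n\times n}$ is nonempty and open. Let $T\in\mathbb{N}$. Then an input $u_{[0,T-1]}\in\mathbb{R}^{mT}$ is $\Sigma_{\mathrm{pk}}$-universal for identification if and only if it is persistently exciting of order $n+1$.
   Context: Let $n,m\in\mathbb{N}$, $\varepsilon\ge 0$, and $\Sigma=\mathbb{R}^{n\times n}\times\mathbb{R}^{n\times m}$. $\Sigma_{\mathrm{cont}}\subseteq\Sigma$ is the set of controllable pairs; $\|\cdot\|$ is the Euclidean norm for vectors and the spectral norm for matrices. A signal $u(0),\dots,u(T-1)\in\mathbb{R}^m$ is identified with the stacked vector $u_{[0,T-1]}\in\mathbb{R}^{mT}$; similarly for $x_{[0,T]}$. For $T\in\mathbb{N}$ and $(A,B)\in\Sigma$, $\mathfrak{B}_T(A,B)$ is the set of all pairs $(u_{[0,T-1]},x_{[0,T]})$, with $u(t)\in\mathbb{R}^m$, $x(t)\in\mathbb{R}^n$, for which there exist $w(0),\dots,w(T-1)\in\mathbb{R}^n$ with $\|w(t)\|\le\varepsilon$ and $x(t+1)=Ax(t)+Bu(t)+w(t)$ for $t=0,\dots,T-1$. $\mathfrak{B}(A,B,u_{[0,T-1]})$ is the set of those elements of $\mathfrak{B}_T(A,B)$ whose input part equals the given $u_{[0,T-1]}$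 (the initial state is free). For a dataset $\mathcal{D}$, $\Sigma_{\mathcal{D}}=\{(A,B)\in\Sigma\mid \mathcal{D}\in\mathfrak{B}_T(A,B)\}$. For a prior knowledge set $\Sigma_{\mathrm{pk}}\subseteq\Sigma$, a dataset $\mathcal{D}\in\mathfrak{B}_T(A,B)$ with $(A,B)\in\Sigma_{\mathrm{pk}}$ is $\Sigma_{\mathrm{pk}}$-informative for identification if $\Sigma_{\mathcal{D}}\cap\Sigma_{\mathrm{pk}}$ is a singleton. An input $u_{[0,T-1]}$ is $\Sigma_{\mathrm{pk}}$-universal for identification if every $\mathcal{D}\in\bigcup_{(A,B)\in\Sigma_{\mathrm{pk}}}\mathfrak{B}(A,B,u_{[0,T-1]})$ is $\Sigma_{\mathrm{pk}}$-informative for identification. For $1\le k\le T$, the Hankel matrix $\mathcal{H}_k(u_{[0,T-1]})$ of depth $k$ is the $mk\times(T-k+1)$ matrix whose $j$-th column ($j=0,\dots,T-k$) is the stacked vector of $u(j),\dots,u(j+k-1)$. The input is persistently exciting of order $k$ if $k\le T$ and $\mathcal{H}_k(u_{[0,T-1]})$ has full row rank. *)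

(* Defs.v *)
From mathcomp Require Export all_boot all_order all_algebra.
From mathcomp Require Export all_classical all_reals all_analysis.
Export numFieldNormedType.Exports.

Set Implicit Arguments.
Unset Strict Implicit.
Unset Printing Implicit Defensive.

Import Order.TTheory GRing.Theory Num.Theory.

Local Open Scope classical_set_scope.
Local Open Scope ring_scope.

Section norms.
Variable R : realType.

(* The library norm on matrices is the entrywise maximum, hence these. *)
Definition euclidean_norm (n : nat) (x : 'cV[R]_n) : R :=
  Num.sqrt (\sum_i x i 0 ^+ 2).

Definition spectral_norm (p q : nat) (M : 'M[R]_(p, q)) : R :=
  sup [set euclidean_norm (M *m x) | x in [set x | euclidean_norm x <= 1]].

End norms.

Section systems.
Variables (R : realType) (n m : nat).

Definition system : Type := 'M[R]_n * 'M[R]_(n, m).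

Definition input (T : nat) : Type := 'I_T -> 'cV[R]_m.

Definition state (T : nat) : Type := 'I_T.+1 -> 'cV[R]_n.

Definition dataset (T : nat) : Type := input T * state T.

(* For t : 'I_T, [widen_ord (leqnSn T) t] and [lift ord0 t] are the indices
   t and t + 1 in 'I_T.+1. *)
Definition behavior (eps : R) (T : nat) (S : system) : set (dataset T) :=
  [set D | exists w : 'I_T -> 'cV[R]_n,
     (forall t, euclidean_norm (w t) <= eps) /\
     (forall t, D.2 (lift ord0 t) =
        S.1 *m D.2 (widen_ord (leqnSn T) t) + S.2 *m D.1 t + w t)].

Definition behavior_of_input (eps : R) (T : nat) (S : system) (u : input T) :
    set (dataset T) :=
  [set D | behavior eps S D /\ D.1 = u].

(* State controllability of the noise-free system: every initial state can be
   steered to every target state in finite time. *)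
Definition controllable (S : system) : Prop :=
  forall x0 x1 : 'cV[R]_n, exists (N : nat) (D : dataset N),
    [/\ behavior 0 S D, D.2 ord0 = x0 & D.2 ord_max = x1].

Definition consistent_systems (eps : R) (T : nat) (D : dataset T) :
    set system :=
  [set S | behavior eps S D].

(* Meant for data generated by a system in [Spk]; this proviso is implied by
   the intersection being nonempty. *)
Definition informative (eps : R) (Spk : set system) (T : nat)
    (D : dataset T) : Prop :=
  exists S : system, consistent_systems eps D `&` Spk = [set S].

Definition universal (eps : R) (Spk : set system) (T : nat)
    (u : input T) : Prop :=
  forall D : dataset T,
    (\bigcup_(S in Spk) behavior_of_input eps S u) D -> informative eps Spk D.

End systems.

Section excitation.
Variables (R : realType) (m : nat).

Lemma hankel_subproof (k T : nat) (hk : (k <= T)%N)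
  (i : 'I_k) (j : 'I_(T - k).+1) : (j + i < T)%N.
Proof.
have hj : (j <= T - k)%N by rewrite -ltnS ltn_ord.
by rewrite -addnS -[leqRHS](subnK hk) leq_add.
Qed.

(* Block row i (of height m) of column j is u (j + i). *)
Definition hankel (k T : nat) (hk : (k <= T)%N) (u : input R m T) :
    'M[R]_(\sum_(i < k) m, (T - k).+1) :=
  \mxcol_(i < k)
    (\matrix_(a < m, j < (T - k).+1) u (Ordinal (hankel_subproof hk i j)) a 0).

Definition persistently_exciting (k T : nat) (u : input R m T) : Prop :=
  exists hk : (k <= T)%N, row_free (hankel hk u).

End excitation.

(* Main.v *)
Require Import Defs.
From mathcomp Require Import all_boot all_order all_algebra.
From mathcomp Require Import all_classical all_reals all_analysis.
Import numFieldNormedType.Exports.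
From mathcomp Require Import zify.

(** Data [x (t+1) = A x t + B u t] identify [(A, B)] exactly when the rows
    [(x t, u t)] satisfy no nontrivial relation [xi x t + eta u t = 0]: such a
    relation is what may be added to a row of [(A, B)] without changing the
    data.  Relations between these rows and linear relations
    [sum_i g_i u (s + i) = 0] between [n + 1] consecutive inputs, that is, left
    kernel vectors of the Hankel matrix of depth [n + 1], can be exchanged for
    each other, in one direction by elimination of the state and in the other
    by an explicit realization.

    Sufficiency ([exciting_annihilator]).  Write a relation
    [xi x (s + i) + eta u (s + i) = 0] in terms of [x s] and of the inputs
    [u s, ..., u (s + i)], and combine the cases [i = 0, ..., n] with the
    coefficients of the characteristic polynomial of [A].  By Cayley-Hamilton
    the state disappears and a left kernel vector of the Hankel matrix remains.
    Persistency of excitation makes it zero; its blocks, read from the last one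
    to the first, give [eta = 0] and [xi B = xi A B = ... = 0], and
    controllability gives [xi = 0].

    Necessity ([universal_exciting]).  Let [g <> 0] be a left kernel vector of
    the Hankel matrix.  Choose [A] in the open set and [b] such that
    [b, A b, ..., A^(n-1) b] is a basis, let [xi] be the row vector with
    [xi A^k b = 0] for [k < n - 1] and [xi A^(n-1) b = 1], and put
    [B = sum_j A^j b g_j].  Replacing [A^j u t] by [u (t + j)] in the input term
    costs only a change of state variable, after which the input enters through
    [b] and the combination [sum_j g_j u (t + j)], which vanishes as long as the
    window fits in the data; what is left at the end of the horizon is too
    recent for [xi] to see it.  Hence for a suitable initial state
    [xi x t + g_n u t = 0] along the data ([annihilated_trajectory]), and these
    data are also explained by [(A + d b xi, B + d b g_n)] for every [d].

    It remains that [(A, B)] and its perturbation lie in the prior set.  The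
    factor [g] may be scaled down, which makes [B] small.  Controllability
    follows from the invertibility of a Krylov matrix
    ([krylov_controllable]), whose determinant is polynomial along any line of
    systems: it is nonzero at a suitable [A] near any given matrix as soon as it
    is nonzero somewhere, for instance at a diagonal matrix with distinct
    entries ([generic_matrix]), and it stays nonzero for small [d]
    ([generic_perturbation]). *)

Local Open Scope classical_set_scope.
Local Open Scope ring_scope.

Set Implicit Arguments.
Unset Strict Implicit.
Unset Printing Implicit Defensive.
Import Order.TTheory GRing.Theory Num.Theory.

(** * Norms *)

Section Norms.
Variable R : realType.

Lemma euclidean_norm0 n : euclidean_norm (0 : 'cV[R]_n) = 0.
Proof.
rewrite /euclidean_norm big1 ?sqrtr0// => i _.
by rewrite mxE expr0n.
Qed.

Lemma euclidean_norm_le0 n (x : 'cV[R]_n) : euclidean_norm x <= 0 -> x = 0.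
Proof.
rewrite /euclidean_norm => x0.
have s0 : \sum_i x i 0 ^+ 2 = 0.
  have s_ge0 : 0 <= \sum_i x i 0 ^+ 2 by apply: sumr_ge0 => i _; exact: sqr_ge0.
  apply/le_anti; rewrite s_ge0 andbT -sqrtr_eq0.
  by rewrite eq_le x0 sqrtr_ge0.
apply/matrixP => i j; rewrite ord1 mxE; apply/eqP.
rewrite -sqrf_eq0; apply/eqP.
exact: (psumr_eq0P (fun k _ => sqr_ge0 (x k 0)) s0).
Qed.

Lemma entry_le_euclidean_norm n (x : 'cV[R]_n) i : `|x i 0| <= euclidean_norm x.
Proof.
rewrite /euclidean_norm -sqrtr_sqr ler_wsqrtr// (bigD1 i)//= lerDl.
by apply: sumr_ge0 => j _; exact: sqr_ge0.
Qed.

Lemma euclidean_norm_le_sum n (x : 'cV[R]_n) :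
  euclidean_norm x <= \sum_i `|x i 0|.
Proof.
have s_ge0 : 0 <= \sum_i `|x i 0| by exact: sumr_ge0.
rewrite -[leRHS]ger0_norm// -sqrtr_sqr ler_wsqrtr// expr2 mulr_sumr.
apply: ler_sum => i _; rewrite -real_normK ?num_real// expr2 ler_wpM2r//.
by rewrite (bigD1 i)//= lerDl sumr_ge0.
Qed.

(** Unlike the spectral norm, of which it is an upper bound, this norm makes
    subadditivity and homogeneity immediate. *)
Definition sum_norm p q (M : 'M[R]_(p, q)) : R := \sum_i \sum_j `|M i j|.

Lemma sum_norm_ge0 p q (M : 'M[R]_(p, q)) : 0 <= sum_norm M.
Proof. by apply: sumr_ge0 => i _; exact: sumr_ge0. Qed.

Lemma sum_normD p q (M N : 'M[R]_(p, q)) :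
  sum_norm (M + N) <= sum_norm M + sum_norm N.
Proof.
rewrite /sum_norm -big_split/=; apply: ler_sum => i _.
rewrite -big_split/=; apply: ler_sum => j _.
by rewrite mxE ler_normD.
Qed.

Lemma sum_normZ p q c (M : 'M[R]_(p, q)) :
  sum_norm (c *: M) = `|c| * sum_norm M.
Proof.
rewrite /sum_norm mulr_sumr; apply: eq_bigr => i _.
rewrite mulr_sumr; apply: eq_bigr => j _.
by rewrite mxE normrM.
Qed.

Lemma entry_le_sum_norm p q (M : 'M[R]_(p, q)) i j : `|M i j| <= sum_norm M.
Proof.
rewrite /sum_norm (bigD1 i)//= (bigD1 j)//= -addrA lerDl addr_ge0//.
  exact: sumr_ge0.
by apply: sumr_ge0 => k _; exact: sumr_ge0.
Qed.

Lemma spectral_norm_le_sum_norm p q (M : 'M[R]_(p, q)) :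
  spectral_norm M <= sum_norm M.
Proof.
apply: ge_sup.
  by exists (euclidean_norm (M *m 0)), 0 => //=; rewrite euclidean_norm0.
move=> _ [x /= x1 <-]; apply: (le_trans (euclidean_norm_le_sum _)).
apply: ler_sum => i _; rewrite mxE (le_trans (ler_norm_sum _ _ _))//.
apply: ler_sum => j _; rewrite normrM ler_piMr//.
exact: le_trans (entry_le_euclidean_norm x j) x1.
Qed.

Lemma open_segment p q (P : set 'M[R]_(p, q)) (A D : 'M[R]_(p, q)) :
  open P -> P A ->
  exists2 e : R, 0 < e & forall d, 0 < d < e -> P (A + d *: D).
Proof.
move=> Popen PA.
have /nbhs_ballP[r/= r0 rP] : nbhs A P by exact: open_nbhs_nbhs.
exists (r / (1 + sum_norm D)) => [|d /andP[d0]].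
  by rewrite divr_gt0// ltr_pwDl// sum_norm_ge0.
rewrite ltr_pdivlMr ?ltr_pwDl ?sum_norm_ge0// => dr.
apply: rP; split=> // i j.
rewrite /ball/= !mxE opprD addrA subrr sub0r normrN normrM.
rewrite gtr0_norm// (le_lt_trans _ dr)// ler_pM2l//.
by rewrite (le_trans (entry_le_sum_norm D i j))// lerDr.
Qed.

(** The [size p] points [e / 2, e / 3, ...] cannot all be roots. *)
Lemma small_nonroot (p : {poly R}) (e : R) :
  p != 0 -> 0 < e -> exists2 d, 0 < d < e & p.[d] != 0.
Proof.
move=> p0 e0; apply: contrapT => noroot.
pose s := [seq e / i.+2%:R | i <- iota 0 (size p)].
have : (size s < size p)%N.
  apply: max_poly_roots => //.
    apply/allP => _ /mapP[i _ ->]; apply/negPn/negP => pi0.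
    apply: noroot; exists (e / i.+2%:R) => //.
    by rewrite divr_gt0//= ltr_pdivrMr// ltr_pMr// ltr1n.
  rewrite map_inj_uniq ?iota_uniq// => i j /(mulfI (lt0r_neq0 e0)) /invr_inj /eqP.
  by rewrite eqr_nat => /eqP [].
by rewrite size_map size_iota ltnn.
Qed.

End Norms.

(** * Krylov matrices *)

Section Krylov.
Variable F : comNzRingType.

Definition krylov n (A : 'M[F]_n) (b : 'cV[F]_n) : 'M[F]_n :=
  \matrix_(i, j) (A ^+ j *m b) i 0.

Lemma krylov_mul n (A : 'M[F]_n) b (c : 'cV[F]_n) :
  krylov A b *m c = \sum_j c j 0 *: (A ^+ j *m b).
Proof.
apply/matrixP => i k; rewrite ord1 !mxE summxE; apply: eq_bigr => j _.
by rewrite !mxE mulrC.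
Qed.

Lemma mul_krylov n (A : 'M[F]_n) b (r : 'rV[F]_n) j :
  (r *m krylov A b) 0 j = (r *m (A ^+ j *m b)) 0 0.
Proof. by rewrite !mxE; apply: eq_bigr => k _; rewrite !mxE. Qed.

End Krylov.

Lemma map_krylov (F K : comNzRingType) (f : {rmorphism F -> K}) n
    (A : 'M[F]_n) b :
  map_mx f (krylov A b) = krylov (map_mx f A) (map_mx f b).
Proof.
apply/matrixP => i j; rewrite !mxE.
have -> : forall k, map_mx f A ^+ k = map_mx f (A ^+ k).
  elim=> [|k IH]; first by rewrite !expr0 map_mx1.
  by rewrite !exprS IH -[X in _ = map_mx f X]/(A *m A ^+ k) map_mxM.
by rewrite rmorph_sum; apply: eq_bigr => k _; rewrite rmorphM !mxE.
Qed.

Lemma expmxSl (F : comNzRingType) n p (A : 'M[F]_n) k (M : 'M[F]_(n, p)) :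
  A ^+ k.+1 *m M = A *m (A ^+ k *m M).
Proof. by rewrite exprS -mulmxA. Qed.

Lemma expmxSr (F : comNzRingType) n p (A : 'M[F]_n) k (M : 'M[F]_(p, n)) :
  M *m A ^+ k.+1 = (M *m A ^+ k) *m A.
Proof. by rewrite exprSr mulmxA. Qed.

Lemma diag_expmx (F : comNzRingType) n (d : 'rV[F]_n) (b : 'cV[F]_n) k i :
  (diag_mx d ^+ k *m b) i 0 = d 0 i ^+ k * b i 0.
Proof.
elim: k i => [|k IH] i; first by rewrite !expr0 mul1mx mul1r.
by rewrite expmxSl mul_diag_mx mxE IH exprS mulrA.
Qed.

(** The Krylov matrix of a diagonal matrix is a transposed Vandermonde matrix
    with rows scaled by [b]. *)
Lemma det_krylov_diag (F : comNzRingType) n (d : 'rV[F]_n) (b : 'cV[F]_n) :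
  \det (krylov (diag_mx d) b) =
    (\prod_i b i 0) * \prod_(i < n) \prod_(j < n | (i < j)%N) (d 0 j - d 0 i).
Proof.
rewrite -det_Vandermonde -[\det (Vandermonde _ _)]det_tr.
have -> : krylov (diag_mx d) b = diag_mx b^T *m (Vandermonde n d)^T.
  by apply/matrixP => i j; rewrite mul_diag_mx [LHS]mxE diag_expmx !mxE mulrC.
by rewrite det_mulmx det_diag; congr (_ * _); apply: eq_bigr => i _; rewrite mxE.
Qed.

(** * Noise-free trajectories and controllability *)

Section Dynamics.
Variables (R : realType) (n m : nat).
Implicit Types (A : 'M[R]_n) (B : 'M[R]_(n, m)).

(** Total sequences allow arithmetic on time indices without bound proofs; the
    windows that overrun the horizon see the value 0. *)
Definition zero_extension T (u : input R m T) (t : nat) : 'cV[R]_m :=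
  oapp u 0 (insub t : option 'I_T).

Lemma zero_extension_ord T (u : input R m T) (t : 'I_T) :
  zero_extension u t = u t.
Proof. by rewrite /zero_extension valK. Qed.

Lemma behavior0P T (S : system R n m) (D : dataset R n m T) :
  behavior 0 S D <-> forall t, (t < T)%N ->
    D.2 (inord t.+1) = S.1 *m D.2 (inord t) + S.2 *m zero_extension D.1 t.
Proof.
have inordS (t : 'I_T) : lift ord0 t = inord t.+1.
  by apply: val_inj; rewrite /= inordK ?ltnS.
have inordW (t : 'I_T) : widen_ord (leqnSn T) t = inord t.
  by apply: val_inj; rewrite /= inordK// ltnS ltnW.
split=> [[w [w0 step]] t tT|step].
  have := step (Ordinal tT).
  rewrite (euclidean_norm_le0 (w0 _)) addr0 inordS inordW => ->.
  by rewrite -(zero_extension_ord _ (Ordinal tT)).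
exists (fun=> 0); split=> [t|t]; first by rewrite euclidean_norm0.
by rewrite addr0 inordS inordW step// zero_extension_ord.
Qed.

Fixpoint trajectory A B (U : nat -> 'cV[R]_m) (x0 : 'cV[R]_n) t :
    'cV[R]_n :=
  if t is t'.+1 then A *m trajectory A B U x0 t' + B *m U t' else x0.

Lemma trajectory_behavior A B (U : nat -> 'cV[R]_m) (x0 : 'cV[R]_n) T :
  behavior 0 (A, B)
    (fun t : 'I_T => U t, fun t : 'I_T.+1 => trajectory A B U x0 t).
Proof.
exists (fun=> 0); split=> [t|t]; first by rewrite euclidean_norm0.
by rewrite addr0.
Qed.

Lemma trajectoryE A B (U : nat -> 'cV[R]_m) (x0 : 'cV[R]_n) t :
  trajectory A B U x0 t =
  A ^+ t *m x0 + \sum_(k < t) A ^+ (t - k.+1) *m (B *m U k).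
Proof.
elim: t => [|t IH] /=; first by rewrite expr0 mul1mx big_ord0 addr0.
rewrite IH mulmxDr -expmxSl -addrA; congr (_ + _).
rewrite big_ord_recr/= subnn expr0 mul1mx mulmx_sumr; congr (_ + _).
apply: eq_bigr => k _; rewrite -expmxSl; congr (A ^+ _ *m _).
by rewrite subSS subnSK.
Qed.

(** The inputs [c j *: f], applied in reverse order of [j], steer the state by
    [krylov A (B *m f) *m c], which is arbitrary. *)
Lemma krylov_controllable A B (f : 'cV[R]_m) :
  krylov A (B *m f) \in unitmx -> controllable (A, B).
Proof.
move=> Kunit x0 x1.
pose c := invmx (krylov A (B *m f)) *m (x1 - A ^+ n *m x0).
pose U k := oapp (c^~ 0) 0 (insub (n - k.+1)%N : option 'I_n) *: f.
exists n, (fun t : 'I_n => U t, fun t : 'I_n.+1 => trajectory A B U x0 t).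
split=> //; first exact: trajectory_behavior.
rewrite /= trajectoryE (reindex_inj rev_ord_inj)/=.
rewrite (eq_bigr (fun k : 'I_n => c k 0 *: (A ^+ k *m (B *m f)))).
  by rewrite -krylov_mul mulKVmx// addrC subrK.
move=> k _; have nkE : (n - (n - k.+1).+1)%N = k :> nat by have := ltn_ord k; lia.
by rewrite /U nkE valK/= -!scalemxAr.
Qed.

(** A row [p] that annihilates all [A ^+ k *m B] vanishes on every state
    reachable from 0, in particular on [p^T]. *)
Lemma controllable_left_kernel A B (p : 'rV[R]_n) :
  controllable (A, B) -> (forall k, p *m A ^+ k *m B = 0) -> p = 0.
Proof.
move=> AB pAB; have [N [D [/behavior0P step D0 DN]]] := AB 0 p^T.
have pX t : (t <= N)%N -> forall k, p *m A ^+ k *m D.2 (inord t) = 0.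
  elim: t => [|t IH] tN k.
    have -> : inord 0 = ord0 :> 'I_N.+1 by apply: val_inj; rewrite /= inordK.
    by rewrite D0 mulmx0.
  rewrite step// mulmxDr !mulmxA pAB mul0mx addr0 -expmxSr IH//.
  exact: ltnW.
have := pX N (leqnn N) 0; rewrite expr0 mulmx1.
have -> : inord N = ord_max :> 'I_N.+1 by apply: val_inj; rewrite /= inordK.
rewrite DN => /matrixP/(_ 0 0); rewrite !mxE => pp0.
apply/matrixP => i j; rewrite ord1 mxE; apply/eqP; rewrite -sqrf_eq0 expr2.
have := psumr_eq0P _ pp0 => /(_ _ j isT); rewrite mxE => ->// k _.
by rewrite mxE -expr2 sqr_ge0.
Qed.

End Dynamics.

(** * Left kernel of the Hankel matrix *)

Lemma row_freeP (F : fieldType) p q (M : 'M[F]_(p, q)) :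
  row_free M <-> (forall v : 'rV_p, v *m M = 0 -> v = 0).
Proof.
split=> [Mfree v /eqP|]; last exact: inj_row_free.
by rewrite mulmx_free_eq0// => /eqP.
Qed.

(** A left kernel vector of the Hankel matrix is a linear recurrence satisfied
    by every full window of the input. *)
Lemma hankel_row_free (R : realType) m k T (kT : (k <= T)%N) (u : input R m T) :
  row_free (hankel kT u) <->
  forall g : 'I_k -> 'rV[R]_m,
    (forall s, (s + k <= T)%N -> \sum_i g i *m zero_extension u (s + i) = 0) ->
    forall i, g i = 0.
Proof.
have mulE (g : 'I_k -> 'rV[R]_m) (s : 'I_(T - k).+1) :
    (\mxrow_i g i *m hankel kT u) 0 s =
    (\sum_i g i *m zero_extension u (s + i)) 0 0.
  rewrite mul_mxrow_mxcol !summxE; apply: eq_bigr => i _; rewrite !mxE.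
  apply: eq_bigr => a _; rewrite mxE.
  by rewrite -(zero_extension_ord u (Ordinal _)).
rewrite row_freeP; split=> [ker0 g gu i|ker0 v vH].
  have /(congr1 (fun M => submxrow M i)) : \mxrow_i g i = 0.
    apply: ker0; apply/matrixP => a s; rewrite ord1 mulE gu ?mxE//.
    by have := ltn_ord s; lia.
  by rewrite mxrowK => ->; apply/matrixP => a b; rewrite !mxE.
rewrite -[v]submxrowK (_ : \mxrow_i submxrow v i = \mxrow_i 0).
  by apply/matrixP => a b; rewrite !mxE.
apply: eq_mxrow => i; apply: ker0 => s sT.
have sk : (s < (T - k).+1)%N by lia.
apply/matrixP => a b; rewrite !ord1 -(mulE _ (Ordinal sk)) submxrowK vH.
by rewrite !mxE.
Qed.

(** * Persistency of excitation is sufficient *)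

Lemma char_poly_annihilates (F : comNzRingType) n (A : 'M[F]_n) :
  \sum_(i < n.+1) (char_poly A)`_i *: A ^+ i = 0.
Proof.
case: n A => [|n] A; first by apply/matrixP => -[].
rewrite -[RHS](Cayley_Hamilton A) [in RHS](_ : char_poly A =
    \sum_(i < n.+2) (char_poly A)`_i *: 'X^i).
  rewrite linear_sum/=; apply: eq_bigr => i _.
  by rewrite linearZ/= rmorphXn/= horner_mx_X.
by rewrite -poly_def -{1}[char_poly A]coefK size_char_poly.
Qed.

Lemma char_poly_lead (F : comNzRingType) n (A : 'M[F]_n) : (char_poly A)`_n = 1.
Proof.
by have /monicP := char_poly_monic A; rewrite lead_coefE size_char_poly.
Qed.

(** Combining the relation at the times [s, ..., s + n] with the coefficients
    of the characteristic polynomial of [A] eliminates the state [X s], so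
    that what remains is a left kernel vector [g] of the Hankel matrix of the
    input. *)
Lemma exciting_annihilator (R : realType) n m T (A : 'M[R]_n) (B : 'M[R]_(n, m))
    (U : nat -> 'cV[R]_m) (X : nat -> 'cV[R]_n)
    (xi : 'rV[R]_n) (eta : 'rV[R]_m) :
  (forall g : 'I_n.+1 -> 'rV[R]_m,
    (forall s, (s + n.+1 <= T)%N -> \sum_i g i *m U (s + i)%N = 0) ->
    forall i, g i = 0) ->
  (forall t, (t < T)%N -> X t.+1 = A *m X t + B *m U t) ->
  (forall t, (t < T)%N -> xi *m X t + eta *m U t = 0) ->
  eta = 0 /\ forall k, xi *m A ^+ k *m B = 0.
Proof.
move=> exciting step rel; pose c i := (char_poly A)`_i.
(* The coefficient of U (s + j) once the state is eliminated. *)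
pose g (j : 'I_n.+1) : 'rV[R]_m :=
  c j *: eta + \sum_(i < n.+1 | (j < i)%N) c i *: (xi *m A ^+ (i - j.+1) *m B).
have relA s i : (s + i < T)%N ->
    xi *m A ^+ i *m X s + \sum_(j < i) xi *m A ^+ (i - j.+1) *m B *m U (s + j)%N
      + eta *m U (s + i)%N = 0.
  move=> siT; rewrite -[RHS](rel (s + i)%N siT); congr (_ + _).
  have -> : X (s + i)%N = trajectory A B (fun j => U (s + j)%N) (X s) i.
    elim: i siT => [|i IH] siT /=; first by rewrite addn0.
    by rewrite addnS step ?IH//; lia.
  rewrite trajectoryE mulmxDr mulmxA mulmx_sumr; congr (_ + _).
  by apply: eq_bigr => j _; rewrite !mulmxA.
have g0 : forall j, g j = 0.
  apply: exciting => s sT.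
  have -> : \sum_j g j *m U (s + j)%N = \sum_(i < n.+1) c i *:
      (xi *m A ^+ i *m X s + \sum_(j < i) xi *m A ^+ (i - j.+1) *m B *m U (s + j)%N
        + eta *m U (s + i)%N).
    under [RHS]eq_bigr do rewrite !scalerDr.
    rewrite !big_split/=.
    have -> : \sum_(i < n.+1) c i *: (xi *m A ^+ i *m X s) = 0.
      under eq_bigr do rewrite scalemxAl scalemxAr.
      by rewrite -mulmx_suml -mulmx_sumr char_poly_annihilates mulmx0 mul0mx.
    rewrite add0r addrC /g.
    under eq_bigr do rewrite mulmxDl -scalemxAl.
    rewrite big_split/=; congr (_ + _).
    under eq_bigr do rewrite mulmx_suml.
    rewrite (exchange_big_dep xpredT)//=; apply: eq_bigr => i _.
    rewrite scaler_sumr [RHS](big_ord_widen n.+1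
      (fun j => c i *: (xi *m A ^+ (i - j.+1) *m B *m U (s + j)%N)));
      last exact: ltnW.
    by apply: eq_bigr => j _; rewrite -scalemxAl.
  by rewrite big1// => i _; rewrite relA ?scaler0//; have := ltn_ord i; lia.
have cn : c n = 1 by exact: char_poly_lead.
(* The blocks g n, g (n - 1), ..., g 0 form a triangular system with unit
   diagonal in eta, xi B, xi A B, ..., xi A^(n-1) B. *)
have eta0 : eta = 0.
  have := g0 ord_max; rewrite /g/= cn scale1r big1 ?addr0// => i ni.
  by have := ltn_ord i; lia.
split=> //; elim/ltn_ind => k IH; have [kn|nk] := ltnP k n.
  have jn : (n - k.+1 < n.+1)%N by lia.
  have := g0 (Ordinal jn); rewrite /g eta0 scaler0 add0r.
  rewrite (bigD1 ord_max)/=; last by lia.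
  rewrite (_ : n - _ = k)%N; last by lia.
  rewrite cn scale1r big1 ?addr0// => i /andP[ji /negP iN].
  rewrite IH ?scaler0//.
  have iltn : (i < n)%N.
    rewrite ltn_neqAle -ltnS ltn_ord andbT.
    by apply/negP => /eqP iE; apply/iN/eqP/val_inj.
  by lia.
(* From k = n on, the recurrence of Cayley-Hamilton takes over. *)
have := char_poly_annihilates A.
move=> /(congr1 (fun M => xi *m (M *m A ^+ (k - n)) *m B)).
rewrite mul0mx mulmx0 mul0mx big_ord_recr/= -/(c n) cn scale1r.
have AD i j : A ^+ i *m A ^+ j = A ^+ (i + j) by rewrite exprD.
rewrite mulmxDl AD subnKC// mulmxDr mulmxDl mulmx_suml mulmx_sumr mulmx_suml.
rewrite big1 ?add0r// => i _.
rewrite -scalemxAl -scalemxAr AD -scalemxAl IH ?scaler0//.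
by have := ltn_ord i; lia.
Qed.

(** The rows of the difference between two consistent systems are relations
    between states and inputs. *)
Lemma exciting_universal (R : realType) n m T (Spk : set (system R n m))
    (u : input R m T) :
  (forall S, Spk S -> controllable S) ->
  persistently_exciting n.+1 u -> universal 0 Spk u.
Proof.
move=> Spk_ctrl [nT /hankel_row_free exciting] D [[A B] SpkS [DS Du]].
exists (A, B); apply/seteqP; split=> [[A' B'] [/= DS' _]|_ ->]; last by split.
move/behavior0P: DS => step; move/behavior0P: DS' => step'.
suff dAB i : row i B' - row i B = 0 /\ row i A' - row i A = 0.
  congr pair; apply/row_matrixP => i; apply/subr0_eq; have [dB dA] := dAB i => //.
have [||dB dAkB] := @exciting_annihilator _ _ _ T A B (zero_extension u)
    (fun t => D.2 (inord t)) (row i A' - row i A) (row i B' - row i B) exciting.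
- by move=> t tT; rewrite step//= Du.
- move=> t tT; rewrite !mulmxBl -!row_mul -!raddfB/=.
  have : A' *m D.2 (inord t) + B' *m zero_extension u t =
      A *m D.2 (inord t) + B *m zero_extension u t.
    by rewrite -Du -step// -step'.
  move=> /eqP; rewrite -subr_eq0 opprD addrACA => /eqP e.
  by rewrite -raddfD/= e raddf0.
by split=> //; apply: controllable_left_kernel dAkB; exact: Spk_ctrl.
Qed.

(** * Generic system matrices *)

Section PolynomialFamilies.
Variable R : realType.

(** Determinants of such families are polynomial functions, hence nonzero at
    arbitrarily small parameters once they are nonzero anywhere. *)
Definition polynomial_family p q (M : R -> 'M[R]_(p, q)) :=
  exists P : 'M[{poly R}]_(p, q), forall x, M x = map_mx (horner_eval x) P.

Lemma polynomial_family_line p q (A D : 'M[R]_(p, q)) :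
  polynomial_family (fun x => A + x *: D).
Proof.
exists (map_mx polyC A + 'X *: map_mx polyC D) => x.
by apply/matrixP => i j; rewrite !mxE /horner_eval !hornerE.
Qed.

Lemma polynomial_family_cst p q (A : 'M[R]_(p, q)) : polynomial_family (fun=> A).
Proof.
by exists (map_mx polyC A) => x; apply/matrixP => i j; rewrite !mxE /horner_eval hornerC.
Qed.

Lemma polynomial_familyM p q r (M : R -> 'M[R]_(p, q)) (N : R -> 'M[R]_(q, r)) :
  polynomial_family M -> polynomial_family N ->
  polynomial_family (fun x => M x *m N x).
Proof. by move=> [P MP] [Q NQ]; exists (P *m Q) => x; rewrite MP NQ map_mxM. Qed.

Lemma polynomial_familyX n (M : R -> 'M[R]_n) k :
  polynomial_family M -> polynomial_family (fun x => M x ^+ k).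
Proof.
move=> MP; elim: k => [|k IH]; first exact: polynomial_family_cst.
have [P PE] := polynomial_familyM MP IH.
by exists P => x; rewrite exprS -PE.
Qed.

Lemma polynomial_familyZ p q c (M : R -> 'M[R]_(p, q)) :
  polynomial_family M -> polynomial_family (fun x => c *: M x).
Proof.
move=> [P MP]; exists (c%:P *: P) => x.
by rewrite MP map_mxZ /= /horner_eval hornerC.
Qed.

Lemma polynomial_family_sum p q N (M : 'I_N -> R -> 'M[R]_(p, q)) :
  (forall i, polynomial_family (M i)) -> polynomial_family (fun x => \sum_i M i x).
Proof.
move=> /choice[P MP]; exists (\sum_i P i) => x.
by rewrite raddf_sum; apply: eq_bigr => i _; rewrite MP.
Qed.

Lemma polynomial_det_krylov n (A : R -> 'M[R]_n) (b : R -> 'cV[R]_n) :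
  polynomial_family A -> polynomial_family b ->
  exists p : {poly R}, forall x, \det (krylov (A x) (b x)) = p.[x].
Proof.
move=> [P AP] [Q bQ]; exists (\det (krylov P Q)) => x.
by rewrite AP bQ -map_krylov det_map_mx.
Qed.

(** Take [d i = s + i], where [s] avoids the roots of the translates
    of [q]. *)
Lemma distinct_nonroots (q : {poly R}) n : q != 0 ->
  exists2 d : 'rV[R]_n, injective (d 0) & forall i, q.[d 0 i] != 0.
Proof.
move=> q0; pose p := \prod_(i < n) (q \Po ('X + (i%:R)%:P)).
have p0 : p != 0.
  apply/prodf_neq0 => i _; rewrite -size_poly_eq0 size_comp_poly2 ?size_poly_eq0//.
  by rewrite size_XaddC.
have [s _ ps] := small_nonroot p0 ltr01.
exists (\row_i (s + i%:R)) => [i j|i].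
  by rewrite !mxE => /addrI/eqP; rewrite eqr_nat => /eqP/val_inj.
move: ps; rewrite /p horner_prod => /prodf_neq0/(_ i isT).
by rewrite horner_comp !hornerE mxE.
Qed.

(** Join a matrix of [P] by a line to a diagonal matrix [C] for which both
    Krylov determinants are nonzero: they remain nonzero at all but finitely
    many points of the line.  With [b] the all-ones vector, the second vector
    has at [C] the entries [q.[d i]], where [q] has coefficients [c], so [d]
    must avoid the roots of [q]. *)
Lemma generic_matrix n (P : set 'M[R]_n) N (c : nat -> R) :
  open P -> P !=set0 -> \poly_(j < N) c j != 0 ->
  exists (A : 'M[R]_n) (b : 'cV[R]_n), [/\ P A, krylov A b \in unitmx &
    krylov A (\sum_(j < N) c j *: (A ^+ j *m b)) \in unitmx].
Proof.
move=> Popen [A0 PA0] c0; have [d dinj dnz] := distinct_nonroots n c0.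
pose b : 'cV[R]_n := const_mx 1; pose C := diag_mx d.
pose comb (A : 'M[R]_n) := \sum_(j < N) c j *: (A ^+ j *m b).
have detC (v : 'cV[R]_n) : (forall i, v i 0 != 0) -> \det (krylov C v) != 0.
  move=> v0; rewrite det_krylov_diag mulf_neq0//; first exact/prodf_neq0.
  apply/prodf_neq0 => i _; apply/prodf_neq0 => j ij.
  by rewrite subr_eq0 (inj_eq dinj) eq_sym neq_ltn ij.
pose A x := A0 + x *: (C - A0).
have A1 : A 1 = C by rewrite /A scale1r addrC subrK.
have Apoly : polynomial_family A by exact: polynomial_family_line.
have bpoly := polynomial_family_cst b.
have [p pE] := polynomial_det_krylov Apoly bpoly.
have [|q qE] := polynomial_det_krylov (b := fun x => comb (A x)) Apoly.
  apply: polynomial_family_sum => j; apply: polynomial_familyZ.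
  by apply: polynomial_familyM => //; exact: polynomial_familyX.
have p0 : p != 0.
  apply: contraTneq (detC b _) => [pz|i]; last by rewrite mxE oner_eq0.
  by rewrite -A1 pE pz horner0 eqxx.
have q0 : q != 0.
  apply: contraTneq (detC (comb C) _) => [qz|i].
    by rewrite -{1}A1 -A1 qE qz horner0 eqxx.
  rewrite summxE (_ : \sum_j _ = (\poly_(j < N) c j).[d 0 i])//.
  rewrite horner_poly; apply: eq_bigr => j _.
  by rewrite mxE diag_expmx mxE mulr1.
have [e e0 eP] := open_segment (C - A0) Popen PA0.
have [x xe] := small_nonroot (mulf_neq0 p0 q0) e0.
rewrite hornerM mulf_eq0 negb_or => /andP[px qx].
by exists (A x), b; split; [exact: eP| |]; rewrite unitmxE unitfE ?pE ?qE.
Qed.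

End PolynomialFamilies.

(** * Realizing a linear recurrence of the input as a relation with the state *)

(** The last row of the inverse of the Krylov matrix. *)
Lemma krylov_dual (F : fieldType) n (A : 'M[F]_n) (b : 'cV[F]_n) :
  krylov A b \in unitmx -> (0 < n)%N ->
  exists xi : 'rV[F]_n, forall k, (k < n)%N ->
    xi *m A ^+ k *m b = (k.+1 == n)%:R%:M.
Proof.
move=> Kunit n0; have n1 : (n.-1 < n)%N by rewrite prednK.
exists (row (Ordinal n1) (invmx (krylov A b))) => k kn.
apply/matrixP => i j; rewrite !ord1 -mulmxA -(mul_krylov _ _ _ (Ordinal kn)).
rewrite -row_mul mulVmx// !mxE eqxx mulr1n -val_eqE/=.
by congr (_%:R); rewrite -(eqn_add2r 1) !addn1 prednK// eq_sym.
Qed.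

Section Annihilated.
Variables (R : realType) (n m T : nat) (A : 'M[R]_n) (b : 'cV[R]_n).
Variables (g : 'I_n.+1 -> 'rV[R]_m) (U : nat -> 'cV[R]_m).

Definition krylov_input_matrix : 'M[R]_(n, m) :=
  \sum_(j < n.+1) A ^+ j *m b *m g j.

(** The states reached at time [t + j] from state 0 at time [t] under the
    input [v]. *)
Definition window (v : nat -> 'cV[R]_n) j t : 'cV[R]_n :=
  \sum_(i < j) A ^+ (j - i.+1) *m v (t + i)%N.

Lemma windowS v j t : window v j.+1 t = A *m window v j t + v (t + j)%N.
Proof.
rewrite /window big_ord_recr/= subnn expr0 mul1mx mulmx_sumr; congr (_ + _).
by apply: eq_bigr => i _; rewrite -expmxSl subSS subnSK.
Qed.

(** Both sides are the response over [t, t + j] to [v], started from 0 at time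
    [t]: the left side separates the contribution of [v t]. *)
Lemma window_shift v j t :
  window v j t.+1 + A ^+ j *m v t = A *m window v j t + v (t + j)%N.
Proof.
elim: j => [|j IH]; first by rewrite /window !big_ord0 mulmx0 !add0r mul1mx addn0.
rewrite [in LHS]windowS expmxSl addrAC -mulmxDr IH -windowS.
by rewrite addnS.
Qed.

(** Adding [F t], the sum over [j] of the [j]-step windows of the input
    [b *m (g j *m U)], to the state turns the input term [A ^+ j *m b *m g j *m U t]
    into [b *m g j *m U (t + j)], so that the new state [z] is driven by the
    recurrence [r] of the input.  Choosing [x0] with [z 0 = 0], [z] stays 0 as
    long as the windows fit in the horizon; the at most [n - 1] later inputs
    do not reach [xi], which annihilates [A ^+ k *m b] for [k < n - 1].
    Finally, [xi] sees of [F t] only the term [g ord_max *m U t], through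
    [A ^+ n.-1 *m b]. *)
Lemma annihilated_trajectory (xi : 'rV[R]_n) : (0 < n)%N ->
  (forall k, (k < n)%N -> xi *m A ^+ k *m b = (k.+1 == n)%:R%:M) ->
  (forall s, (s + n.+1 <= T)%N -> \sum_i g i *m U (s + i)%N = 0) ->
  exists x0, forall t, (t < T)%N ->
    xi *m trajectory A krylov_input_matrix U x0 t + g ord_max *m U t = 0.
Proof.
move=> n0 xiA gU.
pose v (j : 'I_n.+1) t := b *m (g j *m U t).
pose F t := \sum_(j < n.+1) window (v j) j t.
pose x t := trajectory A krylov_input_matrix U (- F 0) t.
pose z t := x t + F t.
pose r s := \sum_(i < n.+1) g i *m U (s + i)%N.
exists (- F 0) => t tT; rewrite -/(x t).
have FS s : F s.+1 + krylov_input_matrix *m U s = A *m F s + b *m r s.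
  rewrite /F /krylov_input_matrix /r mulmx_suml !mulmx_sumr -!big_split/=.
  by apply: eq_bigr => j _; rewrite -window_shift !mulmxA.
have zS s : z s.+1 = A *m z s + b *m r s.
  by rewrite /z /= -addrA [_ *m U s + _]addrC FS mulmxDr addrA.
have xiz s k : (k + s < T)%N -> xi *m A ^+ k *m z s = 0.
  elim: s k => [|s IH] k ksT; first by rewrite /z /= addNr mulmx0.
  rewrite zS mulmxDr !mulmxA -expmxSr IH ?add0r; last by lia.
  have [sT|Ts] := leqP (s + n.+1) T; first by rewrite /r gU// mulmx0.
  rewrite xiA; last by lia.
  by rewrite (_ : (k.+1 == n) = false) ?mul_scalar_mx ?scale0r//; apply/negbTE; lia.
have := xiz t 0 tT; rewrite expr0 mulmx1 mulmxDr => <-; congr (_ + _).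
have xiv (j : 'I_n.+1) i : (i < j)%N ->
    xi *m (A ^+ (j - i.+1) *m v j (t + i)%N) =
    (j == n :> nat)%:R * (i == 0)%:R *: (g j *m U (t + i)%N).
  move=> ij; have jn := ltn_ord j.
  rewrite !mulmxA xiA; last by lia.
  rewrite mul_scalar_mx -scalemxAl -natrM mulnb; congr ((nat_of_bool _)%:R *: _).
  by apply/eqP/andP => [?|[/eqP ? /eqP ?]]; [split; apply/eqP|]; lia.
rewrite mulmx_sumr (bigD1 ord_max)//= big1 ?addr0 => [|j jn].
  rewrite mulmx_sumr; under eq_bigr do rewrite (xiv ord_max)//.
  rewrite (bigD1 (Ordinal n0))//= big1 ?addr0 => [|i i0].
    by rewrite !eqxx mulr1 scale1r addn0.
  by rewrite -val_eqE/= in i0; rewrite (negbTE i0) mulr0 scale0r.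
rewrite mulmx_sumr big1// => i _; rewrite xiv// -val_eqE/= in jn *.
by rewrite (negbTE jn) mul0r scale0r.
Qed.

End Annihilated.

(** * Persistency of excitation is necessary *)

(** The first two conditions hold for all small [d], the third for all but
    finitely many. *)
Lemma generic_perturbation (R : realType) n m (P : set 'M[R]_n) (beta : R)
    (A D : 'M[R]_n) (B E : 'M[R]_(n, m)) (f : 'cV[R]_m) :
  open P -> P A -> sum_norm B < beta -> krylov A (B *m f) \in unitmx ->
  exists2 d : R, d != 0 & [/\ P (A + d *: D), sum_norm (B + d *: E) < beta &
    krylov (A + d *: D) ((B + d *: E) *m f) \in unitmx].
Proof.
move=> Popen PA Bbeta Kunit.
have [e1 e10 e1P] := open_segment D Popen PA.
pose e2 := (beta - sum_norm B) / (1 + sum_norm E).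
have E1 : 0 < 1 + sum_norm E by rewrite ltr_pwDl// sum_norm_ge0.
have e20 : 0 < e2 by rewrite divr_gt0// subr_gt0.
have [p pE] := polynomial_det_krylov (polynomial_family_line A D)
  (polynomial_familyM (polynomial_family_line B E) (polynomial_family_cst f)).
have p0 : p != 0.
  apply: contraTneq Kunit => pz; rewrite unitmxE unitfE negbK.
  by have := pE 0; rewrite !scale0r !addr0 pz horner0 => ->.
have e0 : 0 < Num.min e1 e2 by rewrite lt_min e10.
have [d /andP[d0 de] pd] := small_nonroot p0 e0.
move: de; rewrite lt_min => /andP[de1 de2].
exists d; first exact: lt0r_neq0.
split; [by apply: e1P; rewrite d0| |by rewrite unitmxE unitfE pE].
apply: (le_lt_trans (sum_normD _ _)); rewrite sum_normZ gtr0_norm// -ltrBrDl.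
apply: (le_lt_trans _ (_ : d * (1 + sum_norm E) < _)); last by rewrite -ltr_pdivlMr.
by rewrite ler_pM2l// lerDr.
Qed.

Lemma krylov_input_matrixM (R : realType) n m (A : 'M[R]_n) (b : 'cV[R]_n)
    (g : 'I_n.+1 -> 'rV[R]_m) (f : 'cV[R]_m) :
  krylov_input_matrix A b g *m f =
  \sum_(j < n.+1) (g j *m f) 0 0 *: (A ^+ j *m b).
Proof.
rewrite mulmx_suml; apply: eq_bigr => j _.
by rewrite -mulmxA [in LHS](mx11_scalar (g j *m f)) mul_mx_scalar.
Qed.

Lemma not_exciting_recurrence (R : realType) m n T (u : input R m T) :
  (0 < m)%N -> ~ persistently_exciting n.+1 u ->
  exists g : 'I_n.+1 -> 'rV[R]_m,
    (forall s, (s + n.+1 <= T)%N -> \sum_i g i *m zero_extension u (s + i) = 0) /\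
    exists i a, g i 0 a != 0.
Proof.
move=> m0 notPE; have [nT|Tn] := leqP n.+1 T; last first.
  (* No window fits in the horizon, so every g qualifies. *)
  exists (fun=> const_mx 1); split=> [s|]; first by lia.
  by exists ord0, (Ordinal m0); rewrite mxE oner_eq0.
have /existsNP[g /not_implyP[gu /existsNP[i gi]]] :
    ~ forall g : 'I_n.+1 -> 'rV[R]_m,
    (forall s, (s + n.+1 <= T)%N ->
      \sum_i g i *m zero_extension u (s + i) = 0) ->
    forall i, g i = 0.
  by move=> /(hankel_row_free nT) ufree; apply: notPE; exists nT.
exists g; split=> //; exists i; apply: contrapT => gi0; apply: gi.
apply/matrixP => k a; rewrite ord1 mxE; apply/eqP/negPn/negP => gia.
by apply: gi0; exists a.
Qed.

(** The relation [xi x t + g_n u t = 0] of [annihilated_trajectory] makes the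
    data consistent with both [(A, B)] and [S'], a nearby controllable
    system. *)
Lemma universal_exciting (R : realType) n m (P : set 'M[R]_n) (beta : R) T
    (u : input R m T) :
  (0 < n)%N -> (0 < m)%N -> open P -> P !=set0 -> 0 < beta ->
  universal 0 [set S : system R n m |
    [/\ controllable S, P S.1 & spectral_norm S.2 < beta]] u ->
  persistently_exciting n.+1 u.
Proof.
move=> n0 m0 Popen Pne beta0 uni; apply: contrapT => notPE.
have [g [gu [i0 [a0 gia]]]] := not_exciting_recurrence m0 notPE.
have [|A [b [PA Kb Kc]]] :=
  @generic_matrix _ n P n.+1 (fun j => g (inord j) 0 a0) Popen Pne.
  apply: contraNneq gia => /(congr1 (fun p : {poly R} => p`_i0)).
  by rewrite coef_poly ltn_ord inord_val coef0 => /eqP.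
(* Scaling g makes B small without changing the recurrence. *)
pose B0 := krylov_input_matrix A b g.
have B1 : 0 < 1 + sum_norm B0 by rewrite ltr_pwDl// sum_norm_ge0.
pose s := beta / (1 + sum_norm B0).
have s0 : 0 < s by rewrite divr_gt0.
pose h j := s *: g j; pose B := krylov_input_matrix A b h.
have Bbeta : sum_norm B < beta.
  have -> : B = s *: B0.
    rewrite scaler_sumr; apply: eq_bigr => j _.
    by rewrite scalemxAr.
  rewrite sum_normZ gtr0_norm//.
  apply: (lt_le_trans (_ : _ < s * (1 + sum_norm B0))).
    by rewrite ltr_pM2l// ltrDr.
  by rewrite divfK// gt_eqF.
have hu k : (k + n.+1 <= T)%N -> \sum_i h i *m zero_extension u (k + i) = 0.
  move=> kT; under eq_bigr do rewrite -scalemxAl.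
  by rewrite -scaler_sumr gu// scaler0.
(* The input channel a0, in which g is nonzero, suffices for controllability. *)
pose f : 'cV[R]_m := s^-1 *: delta_mx a0 0.
have Kunit : krylov A (B *m f) \in unitmx.
  rewrite [B *m f](_ : _ = \sum_(j < n.+1) g (inord j) 0 a0 *: (A ^+ j *m b))//.
  rewrite krylov_input_matrixM; apply: eq_bigr => j _; congr (_ *: _).
  rewrite -scalemxAl -scalemxAr scalerA divff ?gt_eqF// scale1r -colE mxE.
  by rewrite inord_val.
have [xi xiA] := krylov_dual Kb n0.
have [x0 xiE] := annihilated_trajectory n0 xiA hu.
have [d d0 [PA' B'beta K'unit]] :=
  @generic_perturbation _ _ _ P beta A (b *m xi) B (b *m h ord_max) f
    Popen PA Bbeta Kunit.
pose D : dataset R n m T :=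
  (u, fun t : 'I_T.+1 => trajectory A B (zero_extension u) x0 t).
have DAB : behavior 0 (A, B) D.
  have uE : u = fun t : 'I_T => zero_extension u t.
    by apply/funext => t; rewrite zero_extension_ord.
  by rewrite /D {1}uE; exact: trajectory_behavior.
pose S' : system R n m := (A + d *: (b *m xi), B + d *: (b *m h ord_max)).
have DAB' : behavior 0 S' D.
  move/behavior0P: DAB => step; apply/behavior0P => t tT.
  rewrite (step t tT) /S' /= !mulmxDl addrACA -[LHS]addr0; congr (_ + _).
  rewrite -!scalemxAl -scalerDr -!mulmxA -mulmxDr inordK; last by lia.
  by rewrite xiE// mulmx0 scaler0.
have in_prior (S : system R n m) : krylov S.1 (S.2 *m f) \in unitmx -> P S.1 ->
    sum_norm S.2 < beta ->
    [/\ controllable S, P S.1 & spectral_norm S.2 < beta].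
  case: S => A1 B1' /= K1 PA1 B1beta; split=> //.
    exact: krylov_controllable K1.
  exact: le_lt_trans (spectral_norm_le_sum_norm _) B1beta.
have [|S SE] := uni D; first by exists (A, B) => //; exact: in_prior.
have AB_S : (A, B) = S.
  suff: [set S] (A, B) by [].
  by rewrite -SE; split=> //; exact: in_prior.
have S'_S : S' = S.
  suff: [set S] S' by [].
  by rewrite -SE; split=> //; exact: in_prior.
(* S' = (A, B) would give b xi = 0, although xi and b pair to 1 through A^(n-1). *)
have /(congr1 (fun M => xi *m A ^+ n.-1 *m (M *m (A ^+ n.-1 *m b)))) : b *m xi = 0.
  have [] : S' = (A, B) by rewrite S'_S.
  rewrite -[RHS]addr0 => /addrI/eqP; rewrite scaler_eq0 (negbTE d0) => /eqP dxi _.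
  exact: dxi.
rewrite mul0mx mulmx0 -(mulmxA b) (mulmxA xi) mulmxA xiA ?prednK// eqxx.
rewrite -scalar_mxM mulr1 => /matrixP/(_ 0 0); rewrite !mxE => /eqP.
by rewrite oner_eq0.
Qed.

Theorem theorem11 (R : realType) (n m : nat) (hn : (0 < n)%N) (hm : (0 < m)%N)
    (Apk : set 'M[R]_n) (Apk_nonempty : Apk !=set0) (Apk_open : open Apk)
    (beta : R) (beta_gt0 : 0 < beta)
    (T : nat) (hT : (0 < T)%N) (u : input R m T) :
  universal 0
    [set S : system R n m |
       [/\ controllable S, Apk S.1 & spectral_norm S.2 < beta]] u
  <-> persistently_exciting n.+1 u.
Proof.
split; first exact: universal_exciting.
by apply: exciting_universal => S [].
Qed.
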